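(* Let $\mathfrak{X}=(X,\{R_i\}_{i=0}^{d})$ be a commutative association scheme which is generated by a non-symmetric relation $R_1$ with valency $k_1>1$, and suppose that \[ R_1^2\subseteq\{R_1,R_{1^*},R_2\},\qquad R_1R_{1^*}\subseteq\{R_0,R_1,R_{1^*},R_2,R_{2^*}\},\qquad 2\notin\{1^*,2^*\}. \] If $k_1\ge k_2$, then $d=4$. Moreover, if in addition $\mathfrak{X}$ is pseudocyclic, then $\mathfrak{X}$ is isomorphic to the cyclotomic scheme $\mathrm{Cyc}(13,4)$.
   Context: A $d$-class association scheme $\mathfrak{X}=(X,\{R_i\}_{i=0}^d)$ consists of a finite set $X$ and nonempty relations $R_i\subseteq X\times X$ such that: $R_0$ is the diagonal; the $R_i$ partition $X\times X$; for each $i$ there is $i^*$ with $R_i^{\mathrm T}=\{(y,x):(x,y)\in R_i\}=R_{i^*}$; and for all $i,j,l$ the number $p_{i,j}^l=|R_i(x)\cap R_{j^*}(y)|$ is independent of the choice of $(x,y)\in R_l$, where $R(x)=\{y:(x,y)\in R\}$. It is commutative if $p_{i,j}^l=p_{j,i}^l$ for all $i,j,l$. The valency of $R_i$ is $k_i=p_{i,i^*}^0$. $R_i$ is symmetric if $i=i^*$, non-symmetric otherwise. For nonempty sets $E,F$ of relations, $EF=\{R_l:\sum_{R_i\in E}\sum_{R_j\in F}p_{i,j}^l\ne0\}$; write $R_iR_j$ for $\{R_i\}\{R_j\}$ and $R_i^2=R_iR_i$. A set $F$ of relations is closed if $R_{i^*}R_j\subseteq F$ for all $R_i,R_j\in F$;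 $R_j$ generates $\mathfrak{X}$ if the smallest closed set containing $R_j$ is $\{R_i\}_{i=0}^d$. For a commutative scheme, the Bose–Mesner algebra spanned by the adjacency matrices has a basis of primitive idempotents $E_0=J/|X|,E_1,\dots,E_d$; the multiplicities are $m_i=\operatorname{rank}E_i$, and the scheme is pseudocyclic if $m_1=\dots=m_d$. For a prime power $q$, a primitive element $\alpha$ of $\mathrm{GF}(q)$ and a divisor $d$ of $q-1$, the cyclotomic scheme $\mathrm{Cyc}(q,d)$ has point set $\mathrm{GF}(q)$, $R_0$ the diagonal, and $(x,y)\in R_i$ iff $x-y\in\alpha^i\langle\alpha^d\rangle$ for $1\le i\le d$. *)

(* Defs.v *)
From mathcomp Require Import all_boot all_order all_algebra all_field.
Set Implicit Arguments. Unset Strict Implicit. Unset Printing Implicit Defensive.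
Import GRing.Theory Num.Theory.

Section Scheme.
Variables (X : finType) (d : nat) (R : 'I_d.+1 -> rel X).

Definition pxy (i j : 'I_d.+1) (x y : X) : nat :=
  #|[set z | R i x z && R j z y]|.

Definition is_scheme : Prop :=
  [/\
      forall i, exists x y, R i x y,
      forall x y, R ord0 x y = (x == y),
      forall x y, #|[set i | R i x y]| = 1,
      forall i, exists j, forall x y, R i y x = R j x y
    &
      forall i j l x y x' y', R l x y -> R l x' y' -> pxy i j x y = pxy i j x' y'].

Definition star (i : 'I_d.+1) : 'I_d.+1 :=
  odflt i [pick j | [forall x, forall y, R i y x == R j x y]].

Definition pnum (i j l : 'I_d.+1) : nat :=
  if [pick xy : X * X | R l xy.1 xy.2] is Some xy then pxy i j xy.1 xy.2 else 0.

Definition commutative_scheme : Prop :=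
  forall i j l, pnum i j l = pnum j i l.

Definition valency (i : 'I_d.+1) : nat := pnum i (star i) ord0.

Definition relprod (E F : {set 'I_d.+1}) : {set 'I_d.+1} :=
  [set l | [exists i in E, exists j in F, pnum i j l != 0]].

Definition closed_set (F : {set 'I_d.+1}) : Prop :=
  forall i j, i \in F -> j \in F -> relprod [set star i] [set j] \subset F.

Definition generates (j : 'I_d.+1) : Prop :=
  forall F, closed_set F -> j \in F -> F = setT.

Local Open Scope ring_scope.
Definition adjmx (i : 'I_d.+1) : 'M[algC]_#|X| :=
  \matrix_(a, b) ((R i (enum_val a) (enum_val b))%:R)%R.

Definition primitive_idempotents (E : 'I_d.+1 -> 'M[algC]_#|X|) : Prop :=
  [/\ forall i, exists c : 'I_d.+1 -> algC, E i = \sum_j (c j *: adjmx j)%R,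
      forall i, E i != 0,
      forall i j, E i *m E j = if i == j then E i else 0,
      (\sum_i E i = 1%:M)%R
    & E ord0 = ((#|X|%:R)^-1 *: const_mx 1)%R].

Definition pseudocyclic : Prop :=
  exists E, primitive_idempotents E /\
    forall i j : 'I_d.+1, i != ord0 -> j != ord0 -> \rank (E i) = \rank (E j).

End Scheme.

Definition scheme_iso (X Y : finType) (d e : nat)
  (R : 'I_d.+1 -> rel X) (S : 'I_e.+1 -> rel Y) : Prop :=
  exists (f : X -> Y) (s : 'I_d.+1 -> 'I_e.+1),
    [/\ bijective f, bijective s & forall i x y, R i x y = S (s i) (f x) (f y)].

(* Cyclotomic scheme Cyc(F, alpha, e): (x,y) ∈ R_i (1 <= i <= e) iff
   x - y ∈ alpha^i <alpha^e>; R_0 the diagonal. *)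
Definition cyc_rel (F : finFieldType) (alpha : F) (e : nat) : 'I_e.+1 -> rel F :=
  fun i x y => if i == ord0 then x == y
               else [exists k : 'I_#|F|, (x - y)%R == (alpha ^+ (i + e * k)%N)%R].

(* Cyc(13,4), with the primitive element 2 of GF(13) *)
Definition Cyc13_4 : 'I_5 -> rel 'F_13 := @cyc_rel _ ((2%:R)%R : 'F_13) 4.

(* Main.v *)
(** Write A, B for the adjacency matrices of R_1, R_2, and A', B' for their
transposes.  The hypotheses read A^2 = pA + qA' + rB and
AA' = kI + p(A + A') + t(B + B').  Comparing (AA)A' with A(AA') gives
r A'B + q A'^2 = kA + pA^2 + t(AB + AB'), whence, for every relation R_m outside
{R_0, R_1, R_1*, R_2, R_2*}, r u_{m*} = t (w_m + u_m) with u_m = p_{1,2*}^m and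
w_m = p_{1,2}^m.  If t = 0, either {R_0, R_1, R_1*} is closed, or q = 0 and
R_1 induces on the out-neighbours of a point a regular tournament without directed
triangles; both are absurd.  For t > 0 the coefficients of the relation above,
together with k_2 <= k_1, force either that no weight leaves the span of
I, A, A', B, B', so that d = 4, or a case where R_2 induces a regular tournament
without directed triangles.  They also give k_2 = k_1, except for r = 0 (a wreath
product).

In the pseudocyclic case, expressing the Casimir element sum_j A_j A_j' / k_j in the
dual bases (A_j) and (E_i) as n sum_i E_i / m_i gives p_{1,2*}^{2*} = t, which leaves
only k = 3 and 13 points.  Such a scheme is recovered from a pair (x_0, x_1) in R_1:
the relations to x_0 and x_1 distinguish all points but two, and an exhaustive search
completes the table of relations in just two ways, which differ by the exchange of
those two points. *)

Require Import Defs.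
From mathcomp Require Import all_boot all_order all_algebra all_field.
From mathcomp Require Import zify ring.
Set Implicit Arguments. Unset Strict Implicit. Unset Printing Implicit Defensive.
Import GRing.Theory Num.Theory.

(** * Intersection numbers *)

Section IntersectionNumbers.
Variables (X : finType) (d : nat) (R : 'I_d.+1 -> rel X).
Hypothesis schR : is_scheme R.

Lemma rel_neq0 i : exists x y, R i x y.
Proof. by case: schR. Qed.

Lemma rel_diag x y : R ord0 x y = (x == y).
Proof. by case: schR. Qed.

Lemma rel_ex x y : exists i, R i x y.
Proof.
have [_ _ + _ _] := schR => /(_ x y)/eqP/cards1P[i /setP/(_ i)].
by rewrite !inE eqxx; exists i.
Qed.

Lemma rel_uniq i j x y : R i x y -> R j x y -> i = j.
Proof.
move=> Ri Rj; have [_ _ + _ _] := schR => /(_ x y)/eqP/cards1P[l /setP e].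
have := e i; rewrite !inE Ri => /esym/eqP->.
by have := e j; rewrite !inE Rj => /esym/eqP->.
Qed.

Lemma rel_star i x y : R (star R i) x y = R i y x.
Proof.
rewrite /star; case: pickP => [j|] /=.
  by move=> /forallP/(_ x)/forallP/(_ y)/eqP.
have [_ _ _ /(_ i)[j ej] _] := schR => /(_ j)/negP[].
by apply/forallP => u; apply/forallP => v; rewrite ej.
Qed.

Lemma starK : involutive (star R).
Proof.
move=> i; have [x [y Rxy]] := rel_neq0 i.
by apply: (@rel_uniq _ _ x y) => //; rewrite !rel_star.
Qed.

Lemma star0 : star R ord0 = ord0.
Proof.
have [x [y Rxy]] := rel_neq0 ord0.
by apply: (@rel_uniq _ _ y x); rewrite ?rel_star // rel_diag eq_sym -rel_diag.
Qed.

Lemma pnumE i j l x y : R l x y -> pnum R i j l = #|[set z | R i x z && R j z y]|.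
Proof.
move=> Rxy; rewrite /pnum; case: pickP => [[u v] /= Ruv|]; last first.
  by move=> /(_ (x, y)) /=; rewrite Rxy.
by have [_ _ _ _ h] := schR; exact: h Ruv Rxy.
Qed.

Lemma pnum_sumE i j l x y : R l x y ->
  pnum R i j l = \sum_(z | R i x z) (R j z y : nat).
Proof.
move=> Rxy; rewrite (pnumE _ _ Rxy) -sum1_card big_mkcond [RHS]big_mkcond.
by apply: eq_bigr => z _; rewrite inE; case: (R i x z); case: (R j z y).
Qed.

Lemma valencyE i x : valency R i = \sum_(y | R i x y) 1.
Proof.
rewrite /valency (@pnum_sumE _ _ _ x x) ?rel_diag //.
by apply: eq_bigr => y; rewrite rel_star => ->.
Qed.

Lemma valency_gt0 i : 0 < valency R i.
Proof.
have [x [y Rxy]] := rel_neq0 i.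
by rewrite (valencyE i x) (bigD1 y).
Qed.

Lemma pnum_neq0 i j l x y z : R i x z -> R j z y -> R l x y -> 0 < pnum R i j l.
Proof.
move=> Rxz Rzy Rxy; rewrite (pnumE _ _ Rxy) card_gt0; apply/set0Pn.
by exists z; rewrite inE Rxz Rzy.
Qed.

Lemma sum_rel (x y : X) (F : 'I_d.+1 -> nat) l : R l x y ->
  \sum_i F i * R i x y = F l.
Proof.
move=> Rxy; rewrite (bigD1 l) //= Rxy muln1 big1 ?addn0 // => i il.
case Ri: (R i x y); rewrite ?muln0 //.
by rewrite (rel_uniq Ri Rxy) eqxx in il.
Qed.

Lemma pnum_star i j l : pnum R (star R i) (star R j) (star R l) = pnum R j i l.
Proof.
have [x [y Rxy]] := rel_neq0 l.
rewrite (pnumE _ _ Rxy) (@pnumE _ _ _ y x) ?rel_star //; congr #|pred_of_set _|.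
by apply/setP => z; rewrite !inE !rel_star andbC.
Qed.

Lemma valency_star i : valency R (star R i) = valency R i.
Proof.
have swap (k : 'I_d.+1) : #|X| * valency R k = \sum_x \sum_y (R k x y : nat).
  rewrite -sum_nat_const; apply: eq_bigr => x _.
  by rewrite (valencyE k x) big_mkcond; apply: eq_bigr => y _; case: (R k x y).
have : #|X| * valency R (star R i) = #|X| * valency R i.
  rewrite !swap exchange_big; apply: eq_bigr => x _.
  by apply: eq_bigr => y _; rewrite rel_star.
have [x _] := rel_neq0 i; have X_gt0 : 0 < #|X| by apply/card_gt0P; exists x.
by move/eqP; rewrite eqn_pmul2l // => /eqP.
Qed.

(** Double count of the pairs [(z, y)] with [R i x z] and [R j z y], for a fixed [x]. *)
Lemma sum_pnum_l i j : \sum_l valency R l * pnum R i j l = valency R i * valency R j.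
Proof.
have [x _] := rel_neq0 i.
transitivity (\sum_y \sum_(z | R i x z) (R j z y : nat)).
  under eq_bigr => l _.
    rewrite (valencyE l x) big_distrl /=.
    under eq_bigr => y Ry do rewrite mul1n (pnum_sumE _ _ Ry).
    over.
  rewrite (exchange_big_dep predT) //=; apply: eq_bigr => y _.
  have [e Re] := rel_ex x y; rewrite (bigD1 e) //= [X in _ + X]big1 ?addn0 // => l /andP[Rl].
  by rewrite (rel_uniq Rl Re) eqxx.
rewrite exchange_big (valencyE i x) big_distrl /=; apply: eq_bigr => z _.
rewrite mul1n (valencyE j z) big_mkcond.
by rewrite [RHS]big_mkcond; apply: eq_bigr => y _; case: (R j z y).
Qed.

(** Both sides count the triangles [R i x z], [R j z y], [R l x y] on a fixed [x], once by [y] and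
    once by [z]. *)
Lemma pnum_triangle i j l :
  valency R l * pnum R i j l = valency R i * pnum R l (star R j) i.
Proof.
have [x _] := rel_neq0 i.
transitivity (\sum_(y | R l x y) \sum_(z | R i x z) (R j z y : nat)).
  rewrite (valencyE l x) big_distrl /=; apply: eq_bigr => y Ry.
  by rewrite mul1n (pnum_sumE _ _ Ry).
rewrite exchange_big (valencyE i x) big_distrl /=; apply: eq_bigr => z Rz.
by rewrite mul1n (pnum_sumE _ _ Rz); apply: eq_bigr => y _; rewrite rel_star.
Qed.

(** Counts the paths of length three from [x] to [y], split at either inner vertex; this is
    associativity of the Bose-Mesner algebra. *)
Lemma pnum_assoc i j l m :
  \sum_e pnum R i j e * pnum R e l m = \sum_e pnum R j l e * pnum R i e m.
Proof.
have [x [y Rxy]] := rel_neq0 m.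
transitivity (\sum_w \sum_z (R i x z && R j z w && R l w y : nat)).
  under eq_bigr => e _.
    rewrite (pnum_sumE _ _ Rxy) big_distrr /=.
    under eq_bigr => w Rw do rewrite (pnum_sumE _ _ Rw).
    over.
  rewrite (exchange_big_dep predT) //=; apply: eq_bigr => w _.
  have [e Re] := rel_ex x w; rewrite (bigD1 e) //= [X in _ + X]big1 ?addn0; last first.
    by move=> f /andP[Rf]; rewrite (rel_uniq Rf Re) eqxx.
  rewrite big_distrl [LHS]big_mkcond /=; apply: eq_bigr => z _.
  by case: (R i x z); case: (R j z w); case: (R l w y).
rewrite exchange_big /=; symmetry.
under eq_bigr => e _.
  rewrite (pnum_sumE _ _ Rxy) big_distrr /=.
  over.
rewrite exchange_big [LHS]big_mkcond /=; apply: eq_bigr => z _.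
have [e Re] := rel_ex z y; case Ri: (R i x z); last by rewrite big1.
rewrite (sum_rel (fun e => pnum R j l e) Re) (pnum_sumE _ _ Re) big_mkcond.
by apply: eq_bigr => w _; case: (R j z w); case: (R l w y).
Qed.

Lemma pnum0r i l : pnum R i ord0 l = (i == l).
Proof.
have [x [y Rxy]] := rel_neq0 l.
rewrite (pnum_sumE _ _ Rxy) big_mkcond (bigD1 y) //= rel_diag eqxx big1 => [|z zy].
  rewrite addn0; case: eqP => [->|il]; first by rewrite Rxy.
  by case: ifP => // /rel_uniq/(_ Rxy).
by rewrite rel_diag (negPf zy) if_same.
Qed.

Lemma pnum0l j l : pnum R ord0 j l = (j == l).
Proof. by rewrite -pnum_star star0 pnum0r (inj_eq (inv_inj starK)). Qed.

Lemma pnum_at0 i j : pnum R i j ord0 = valency R i * (star R i == j).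
Proof.
have [x _] := rel_neq0 ord0.
rewrite (@pnum_sumE _ _ _ x x) ?rel_diag // (valencyE i x) big_distrl /=.
apply: eq_bigr => z Rz; rewrite mul1n; case: eqP => [<-|ne].
  by rewrite rel_star Rz.
case Rj: (R j z x) => //; case: ne; apply: rel_uniq Rj.
by rewrite rel_star.
Qed.

Lemma sum_valency : \sum_i valency R i = #|X|.
Proof.
have [x _] := rel_neq0 ord0.
under eq_bigr do rewrite (valencyE _ x) big_mkcond.
rewrite exchange_big -sum1_card; apply: eq_bigr => y _.
have [e Re] := rel_ex x y; rewrite -[RHS](sum_rel (fun=> 1) Re).
by apply: eq_bigr => i _; case: (R i x y).
Qed.

End IntersectionNumbers.

(** * Arithmetic of the parameters *)

(** Eliminating [q] leaves a multiple of [u]; after division by [u], a factor [t] allows [v * t] to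
    be replaced by [u * r]. Integers are used because [2 * t - r] may be negative. *)
Lemma parameters_of_balance (u v t r p q : int) :
  (u != 0 -> v * t = u * r -> q + v = 1 + p + 2 * u ->
  r * v + q * q = 1 + 2 * p + 2 * u + p * p + 2 * t * u ->
  (2 * t - r) * (t + u * (2 * t - r) + 2 * p * t) = t * (r + 2 * t * t - r * r))%R.
Proof.
move=> u0 vt qv bal.
have eq_q : (q = 1 + p + 2 * u - v)%R by lia.
have : (u * ((2 * t - r) * (1 + 2 * u - v + 2 * p) - (r + 2 * t * t - r * r)) = 0)%R.
  move: bal; rewrite eq_q => bal.
  have h1 : (t * (r * v + (1 + p + 2 * u - v) * (1 + p + 2 * u - v)) =
             t * (1 + 2 * p + 2 * u + p * p + 2 * t * u))%R by rewrite bal.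
  have h2 : (v * (v * t) = v * (u * r))%R by rewrite vt.
  have h3 : (p * (v * t) = p * (u * r))%R by rewrite vt.
  have h4 : (u * (v * t) = u * (u * r))%R by rewrite vt.
  have h5 : (r * (v * t) = r * (u * r))%R by rewrite vt.
  lia.
move/eqP; rewrite mulf_eq0 (negPf u0) => /eqP h.
have h1 : ((2 * t - r) * (v * t) = (2 * t - r) * (u * r))%R by rewrite vt.
have h2 : (t * ((2 * t - r) * (1 + 2 * u - v + 2 * p) - (r + 2 * t * t - r * r)) = 0)%R.
  by rewrite h mulr0.
lia.
Qed.

(** In the application [u], [v], [a], [b] are the values of p_{1,2*} at R_1, R_1*, R_2*, R_2, [c] is
    p_{1,2}^{2*}, and [k2 * g] is the weight of A B' outside the span of I, A, A', B, B'. The cases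
    are r < t, t < r <= 2t, r > 2t and r = t. *)
Lemma parameters_dichotomy (k k2 p q r t u v a b c g : nat) :
  0 < k2 -> k2 <= k -> 0 < t -> 0 < r ->
  k * u = k2 * t -> k * v = k2 * r ->
  k = p + q + v -> k = 1 + 2 * p + 2 * u ->
  r * v + q * q = k + p * p + 2 * t * u ->
  r * a = p * r + t * (a + b) -> r * b + q * r = t * (c + a) ->
  k = t + r + a + b + g -> t * g <= r * g ->
  [/\ r = t, p = 0, b = 0, a = 0 & 0 < u] \/
  [/\ g = 0, k2 = k
    & a = t -> [/\ t = 1, r = 1, p = 0, b = 0 & q = 2] /\ c = 1 ].
Proof.
move=> k2_gt0 k2_le t_gt0 r_gt0 Eu Ev Ek Ek' E3 E5 E4 E6 g_le.
have k_gt0 : 0 < k by lia.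
have vt : v * t = u * r.
  by apply/eqP; rewrite -(eqn_pmul2l k_gt0) !mulnA Ev Eu mulnAC.
have u_gt0 : 0 < u by rewrite lt0n; apply/eqP => u0; move: Eu; rewrite u0 muln0; clear -k2_gt0 t_gt0; nia.
have u_le : u <= t by rewrite -(leq_pmul2l k_gt0) Eu leq_mul2r k2_le orbT.
have bal := @parameters_of_balance (Posz u) (Posz v) (Posz t)
  (Posz r) (Posz p) (Posz q).
have {}bal : (((2 * Posz t - Posz r) * (Posz t + Posz u * (2 * Posz t - Posz r) + 2 * Posz p * Posz t) =
  Posz t * (Posz r + 2 * Posz t * Posz t - Posz r * Posz r)))%R.
  by apply: bal; lia.
have k2E : u = t -> k2 = k.
  by move=> e; apply/eqP; rewrite -(eqn_pmul2r t_gt0) -Eu e.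
have [r_lt|r_gt|rt] := ltngtP r t.
- exfalso.
  have [s [s_gt0 Es]] : exists s, 0 < s /\ t = r + s by exists (t - r); lia.
  have z : p * r + s * a + t * b + s * g = 0.
    by move: E5 g_le; rewrite Es; clear; nia.
  have [p0 a0 b0 g0] : [/\ p = 0, a = 0, b = 0 & g = 0].
    by move: z; clear -s_gt0 r_gt0 t_gt0; split; nia.
  subst a p b g.
  have e : Posz (t + r) = Posz (1 + 2 * u) by lia.
  have : (Posz r * Posz r * (Posz r - Posz t - 1) = 0)%R.
    have : (2 * (Posz u * (2 * Posz t - Posz r)) =
            (Posz t + Posz r - 1) * (2 * Posz t - Posz r))%R.
      rewrite mulrA; congr (_ * _)%R; lia.
    move=> e2.
    have := congr1 ( *%R (2 * Posz t - Posz r)%R) e2.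
    lia.
  by clear -r_gt0 r_lt; nia.
- case: (leqP r (2 * t)) => r_le.
  + right.
    have [s [s_gt0 Es]] : exists s, 0 < s /\ r = t + s.
      by exists (r - t); lia.
    have [x Ex] : exists x, t = u + x by exists (t - u); lia.
    have [y Ey] : exists y, t = s + y by exists (t - s); lia.
    (* This is [E6] times [s], with [a] eliminated by [E5]. No term on the right is negative, so [s]
       is 1 and the remaining terms vanish. *)
    have key : s = s * s + 2 * s * x + s * b + s * g + p * y + t * b.
      have := congr1 (muln s) E6; rewrite Ek'.
      have := congr1 (muln s) Ex; have := congr1 (muln s) Ey.
      by have := congr1 (muln p) Ey; have := E5; rewrite Es; clear; lia.
    have s1 : s = 1 by clear -key s_gt0; nia.
    subst s.
    have [x0 b0 g0 py0] : [/\ x = 0, b = 0, g = 0 & p * y = 0].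
      by clear -key t_gt0; split; nia.
    subst x b g; split=> //; first by apply: k2E; lia.
    move=> Ea; exfalso; subst a.
    move/eqP: py0; rewrite muln_eq0 => /orP[]/eqP z0.
      by move: E5; rewrite z0; clear -t_gt0 Es; nia.
    by move: E5; rewrite Es Ey z0; clear; nia.
  + right.
    have [e [e_gt0 Ee]] : exists e, 0 < e /\ r = 2 * t + e.
      by exists (r - 2 * t); lia.
    have [x Ex] : exists x, t = u + x by exists (t - u); lia.
    have star1 : 2 * p * e * t + t * (2 * t + 2 * e) =
       t * (2 * t * t + 4 * t * e + e * e) + e * e * u.
      by move: bal; rewrite Ee; lia.
    have star2 : p * e + (t + e) = (t + e) * (t + e + 2 * x + b + g) + t * b.
      have := congr1 (muln (t + e)) E6; rewrite Ek'.
      by have := E5; rewrite Ee; lia.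
    have star3 := congr1 (muln (2 * t)) star2.
    (* The difference of [star3] and [star1]: the terms in [p] cancel and only nonnegative ones
       survive. *)
    have key : 2 * t * (t + e) * (2 * x + b + g) + 2 * t * t * b + e * e * x = 0.
      have := congr1 (muln (e * e)) Ex; lia.
    have [x0 b0 g0] : [/\ x = 0, b = 0 & g = 0].
      by clear -key t_gt0 e_gt0; split; nia.
    subst x b g; split=> //; first by apply: k2E; lia.
    move=> Ea; exfalso; subst a.
    move: E5; rewrite Ee => E5.
    have E7 : p * e * (2 * t + e) = t * e * (t + e).
      by have := congr1 (muln e) E5; lia.
    have E8 : p * e * (2 * t + e) + (t + e) * (2 * t + e) = (t + e) * (t + e) * (2 * t + e).
      by have := congr1 (muln (2 * t + e)) star2; lia.
    have E9 : t * e + (2 * t + e) = (t + e) * (2 * t + e).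
      by apply/eqP; rewrite -(eqn_pmul2l (_ : 0 < t + e)); [apply/eqP|]; lia.
    by clear -E9 e_gt0 t_gt0; nia.
- subst r.
  have [p0 b0] : p = 0 /\ b = 0 by clear -E5 t_gt0; split; nia.
  subst p b.
  have uv : v = u by apply/eqP; rewrite -(eqn_pmul2r t_gt0) vt.
  subst v.
  have Eq : q = 1 + u by lia.
  have ut : u = t by subst q; clear -E3 Ek' u_gt0; nia.
  subst u.
  have k2k := k2E erefl.
  (* Now k = 1 + 2t, so [E6] reads a + g = 1: either a = 0, or a = 1 and g = 0. *)
  case: a E5 E4 E6 => [|a] E5 E4 E6; first by left; split.
  right; split; [lia|exact: k2k|].
  move=> Ea; have : t = 1 by lia.
  move=> t1; subst t; split; first by split=> //; lia.
  by lia.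
Qed.

(** * Primitive idempotents *)

(** In a full rank factorization E = CB, idempotence forces BC = 1, and tr(CB) = tr(BC). *)
Lemma mxtrace_idem (K : fieldType) n (E : 'M[K]_n) :
  (E *m E = E -> \tr E = (\rank E)%:R)%R.
Proof.
move=> idE; have := mulmx_base E.
move: (row_base E) (col_base E) (row_base_free E) (col_base_full E) => B C fB fC CB.
have BC : (B *m C = 1%:M)%R.
  apply: (row_free_inj fB); apply: (row_full_inj fC).
  by rewrite mul1mx !mulmxA CB -mulmxA CB idE.
by rewrite -[in LHS]CB mxtrace_mulC BC mxtrace1.
Qed.

Section Pseudocyclic.
Variables (X : finType) (d : nat) (R : 'I_d.+1 -> rel X).
Hypothesis schR : is_scheme R.
Local Open Scope ring_scope.
Local Notation n := #|X|.
Local Notation A := (adjmx R).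
Local Notation P := (pnum R).
Local Notation val := (valency R).

Lemma adjmxE (x y : X) i : A i (enum_rank x) (enum_rank y) = (R i x y)%:R.
Proof. by rewrite mxE !enum_rankK. Qed.

Lemma adjmx_sumE (x y : X) (F : 'I_d.+1 -> algC) l : R l x y ->
  (\sum_i F i *: A i) (enum_rank x) (enum_rank y) = F l.
Proof.
move=> Rl; rewrite summxE (bigD1 l) //= mxE adjmxE Rl mulr1 big1 ?addr0 // => i il.
rewrite mxE adjmxE; case Ri: (R i x y); rewrite ?mulr0 //.
by rewrite (rel_uniq schR Ri Rl) eqxx in il.
Qed.

Lemma mul_adjmx i j : A i *m A j = \sum_l (P i j l)%:R *: A l.
Proof.
apply/matrixP => a b; rewrite -(enum_valK a) -(enum_valK b).
have [l Rl] := rel_ex schR (enum_val a) (enum_val b).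
rewrite (adjmx_sumE (fun l => (P i j l)%:R) Rl) mxE (pnumE schR _ _ Rl) -sum1_card natr_sum.
rewrite (reindex_onto (@enum_rank X) enum_val) => [|c _]; last exact: enum_valK.
rewrite [RHS]big_mkcond; apply: eq_big => [z|z _]; first by rewrite enum_rankK eqxx.
by rewrite !adjmxE inE; case: (R i _ _); case: (R j _ _); rewrite ?mulr0 ?mul0r ?mulr1.
Qed.

Lemma tr_adjmx l : \tr (A l) = n%:R * (l == ord0)%:R.
Proof.
rewrite /mxtrace (eq_bigr (fun=> (l == ord0)%:R)) => [|a _].
  by rewrite sumr_const card_ord mulr_natl.
rewrite mxE; congr (_ %:R); have [->|ne] := eqVneq; first by rewrite rel_diag // eqxx.
case Rl: (R l _ _) => //; case/eqP: ne; apply: (rel_uniq schR Rl).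
by rewrite rel_diag.
Qed.

Lemma tr_mul_adjmx i j : \tr (A i *m A (star R j)) = (i == j)%:R * (n * val j)%:R.
Proof.
rewrite mul_adjmx raddf_sum (bigD1 ord0) //= big1 ?addr0 => [|l l0]; last first.
  by rewrite mxtraceZ tr_adjmx (negPf l0) !mulr0.
rewrite mxtraceZ tr_adjmx eqxx mulr1 pnum_at0 // (inj_eq (inv_inj (starK schR))).
by case: eqP => [->|_]; rewrite ?muln0 ?mul0r // muln1 mul1r natrM mulrC.
Qed.

Variable E : 'I_d.+1 -> 'M[algC]_n.
Hypothesis idE : primitive_idempotents R E.

(** For the trace form, the basis dual to (A_j) is A_j' / (n k_j) and the one dual to (E_i) is E_i /
    m_i; both sides are n times the Casimir element. *)
Lemma sum_adjmx_idem :
  \sum_j (val j)%:R^-1 *: (A j *m A (star R j)) = \sum_i (n%:R / (\rank (E i))%:R) *: E i.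
Proof.
have [Espan E0 EE _ _] := idE.
have [c cE] : exists c : 'M[algC]_d.+1, forall i, E i = \sum_j c i j *: A j.
  have /fin_all_exists[c cE] := Espan.
  exists (\matrix_(i, j) c i j) => i; rewrite cE.
  by apply: eq_bigr => j _; rewrite mxE.
pose m i : algC := (\rank (E i))%:R.
have m0 i : m i != 0 by rewrite pnatr_eq0 mxrank_eq0.
have trEE i l : \tr (E i *m E l) = (i == l)%:R * m l.
  rewrite EE; case: eqP => [->|_]; last by rewrite mxtrace0 mul0r.
  by rewrite mxtrace_idem ?EE ?eqxx // mul1r.
(* The candidate eigenvalues of A_j; the traces of E_i E_l show that this matrix inverts [c]. *)
pose p := \matrix_(j, i) (\tr (A j *m E i) / m i).
have pc : p *m c = 1%:M.
  apply: mulmx1C; apply/matrixP => i l; rewrite !mxE.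
  transitivity (\tr (E i *m E l) / m l); last first.
    by rewrite trEE mulfK.
  rewrite [E i in RHS]cE mulmx_suml raddf_sum mulr_suml; apply: eq_bigr => j _.
  by rewrite mxE /= -scalemxAl mxtraceZ mulrA.
have AE j : A j = \sum_i p j i *: E i.
  under eq_bigr => i _ do rewrite cE scaler_sumr.
  rewrite exchange_big /= (bigD1 j) //= [X in _ + X]big1 ?addr0 => [|l lj].
    under eq_bigr do rewrite scalerA.
    rewrite -scaler_suml; have := congr1 (fun M : 'M_d.+1 => M j j) pc.
    by rewrite !mxE eqxx => ->; rewrite scale1r.
  under eq_bigr do rewrite scalerA.
  rewrite -scaler_suml; have := congr1 (fun M : 'M_d.+1 => M j l) pc.
  by rewrite !mxE eq_sym (negPf lj) => ->; rewrite scale0r.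
have pstar j i : p (star R j) i = c i j * (n * val j)%:R / m i.
  rewrite mxE mxtrace_mulC cE mulmx_suml raddf_sum (bigD1 j) //= big1 => [|l lj].
    by rewrite addr0 -scalemxAl mxtraceZ tr_mul_adjmx eqxx mul1r.
  by rewrite -scalemxAl mxtraceZ tr_mul_adjmx (negPf lj) mul0r mulr0.
transitivity (\sum_j \sum_i (c i j * (n%:R / m i)) *: (A j *m E i)).
  apply: eq_bigr => j _; rewrite [A (star R j)]AE mulmx_sumr scaler_sumr.
  apply: eq_bigr => i _; rewrite -scalemxAr scalerA pstar natrM; congr (_ *: _).
  have v0 : (val j)%:R != 0 :> algC by rewrite pnatr_eq0 -lt0n valency_gt0.
  by field; rewrite m0 v0.
rewrite exchange_big; apply: eq_bigr => i _.
under eq_bigr do rewrite mulrC -scalerA scalemxAl.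
by rewrite -scaler_sumr -mulmx_suml -cE EE eqxx.
Qed.

(** The first part is the trace of the sum of the E_i. For the second, equal multiplicities turn the
    Casimir element into n E_0 + (n/m)(I - E_0), whose off-diagonal entries are 1 - 1/m. *)
Lemma pseudocyclic_sum (m : nat) : (forall i, i != ord0 -> \rank (E i) = m) ->
  n = (d * m).+1 /\
  forall l, l != ord0 -> \sum_j (P j (star R j) l)%:R / (val j)%:R = 1 - m%:R^-1 :> algC.
Proof.
move=> rkE; have [_ Ene EE Esum E0] := idE.
have n0 : n%:R != 0 :> algC.
  have [x _] := rel_neq0 schR ord0.
  by rewrite pnatr_eq0 -lt0n; apply/card_gt0P; exists x.
have tr0 : \tr (E ord0) = 1.
  rewrite E0 mxtraceZ /mxtrace (eq_bigr (fun=> 1)) => [|i _]; last by rewrite mxE.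
  by rewrite sumr_const card_ord mulVf.
have rk0 : (\rank (E ord0))%:R = 1 :> algC by rewrite -mxtrace_idem ?tr0 // EE eqxx.
split.
  apply/eqP; rewrite -(eqr_nat algC) -[n%:R]mxtrace1 -Esum raddf_sum (bigD1 ord0) //=.
  rewrite tr0 (eq_bigr (fun=> m%:R)) => [|i i0]; last by rewrite mxtrace_idem ?EE ?eqxx // rkE.
  by rewrite sumr_const cardC1 card_ord /= -mulrnA mulnC -mulrS.
move=> l l0; have [x [y Rl]] := rel_neq0 schR l.
have xy : x != y by apply: contraNneq l0 => xy; apply/eqP; apply: (rel_uniq schR Rl); rewrite rel_diag // xy.
have := congr1 (fun M : 'M_n => M (enum_rank x) (enum_rank y)) sum_adjmx_idem.
rewrite /= summxE => lhs.
transitivity (\sum_j ((val j)%:R^-1 *: (A j *m A (star R j))) (enum_rank x) (enum_rank y)).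
  apply: eq_bigr => j _; rewrite mxE mul_adjmx.
  by rewrite (adjmx_sumE (fun l => (P j (star R j) l)%:R) Rl) mulrC.
rewrite lhs (bigD1 ord0) //= rk0 divr1.
have -> : \sum_(i | i != ord0) (n%:R / (\rank (E i))%:R) *: E i =
    (n%:R / m%:R) *: (1%:M - E ord0).
  rewrite -Esum [X in _ *: (X - _)](bigD1 ord0) //= addrAC subrr add0r scaler_sumr.
  by apply: eq_bigr => i i0; rewrite rkE.
rewrite E0 !mxE (inj_eq enum_rank_inj) (negPf xy) mulr1 mulfV // sub0r.
by rewrite mulrN mulrAC mulfV // mul1r.
Qed.

End Pseudocyclic.

(** * Labellings of 13 points *)

(* [cyc13 x y] is the class of [x - y] in F_13: class [l > 0] is 2^l<2^4>, class 0 is {0}. *)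
Definition cyc13_class : seq nat := [:: 0; 4; 1; 4; 2; 1; 1; 3; 3; 4; 2; 3; 2].
Definition cyc13 (x y : nat) : nat := nth 0 cyc13_class ((x + (13 - y)) %% 13).

(** Since -1 = 2^6 in GF(13), transposition shifts the nonzero classes by 2 modulo 4. *)
Definition star5 (l : nat) : nat := nth 0 [:: 0; 3; 4; 1; 2] l.

(* The intersection numbers p_{a,b}^1 of Cyc(13,4). *)
Definition cyc13_num (a b : nat) : nat :=
  nth 0 (nth [::] [:: [:: 0; 1; 0; 0; 0]; [:: 1; 0; 1; 0; 1]; [:: 0; 1; 0; 1; 1];
                      [:: 0; 0; 1; 2; 0]; [:: 0; 1; 1; 0; 1]] a) b.

(* The points 2 and 5 have the same relations to 0 and to 7. *)
Definition swap25 (x : nat) : nat := if x == 2 then 5 else if x == 5 then 2 else x.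

(* Partial 13 x 13 tables of labels, the value 5 standing for an unknown entry. *)
Definition table := seq (seq nat).
Definition entry (M : table) (i j : nat) : nat := nth 5 (nth [::] M i) j.
Definition update (M : table) (i j l : nat) : table :=
  set_nth [::] M i (set_nth 5 (nth [::] M i) j l).

Lemma entry_update M i j l x y :
  entry (update M i j l) x y = if (x == i) && (y == j) then l else entry M x y.
Proof.
rewrite /entry /update nth_set_nth /=.
by case: eqP => [->|_] //=; rewrite nth_set_nth /=; case: eqP.
Qed.

(** Only known entries are counted and only an upper bound is tested, so a partial table that
    extends to a valid labelling is never rejected. *)
Definition paths_ok (M : table) (x y w : nat) : bool :=
  let a := entry M x w in let b := entry M w y in
  if [&& entry M x y == 1, a != 5 & b != 5] then
    count (fun z => (entry M x z == a) && (entry M z y == b)) (iota 0 13) <= cyc13_num a b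
  else true.

(** Filling the entries at [(i, j)] and [(j, i)] affects only triples containing both points; all
    six orders of such a triple are tested. *)
Definition consistent_at (M : table) (i j : nat) : bool :=
  all (fun z => [&& paths_ok M i j z, paths_ok M j i z, paths_ok M i z j,
                    paths_ok M z i j, paths_ok M j z i & paths_ok M z j i]) (iota 0 13).

Definition all_pairs : seq (nat * nat) := [seq (i, j) | i <- iota 0 13, j <- iota 0 13].

Definition final_ok (M : table) : bool :=
  all (fun ij => entry M ij.1 ij.2 == cyc13 ij.1 ij.2) all_pairs ||
  all (fun ij => entry M ij.1 ij.2 == cyc13 (swap25 ij.1) (swap25 ij.2)) all_pairs.

(* [if] instead of a boolean connective: [vm_compute] evaluates both arguments of the latter. *)
Fixpoint search (cells : seq (nat * nat)) (M : table) : bool :=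
  if cells is (i, j) :: cells' then
    all (fun l => let M' := update (update M i j l) j i (star5 l) in
           if consistent_at M' i j then search cells' M' else true) [:: 1; 2; 3; 4]
  else final_ok M.

Lemma search_step i j cells M l : search ((i, j) :: cells) M -> l \in [:: 1; 2; 3; 4] ->
  let M' := update (update M i j l) j i (star5 l) in
  consistent_at M' i j -> search cells M'.
Proof.
move=> srch lin M' ok.
suff : if consistent_at M' i j then search cells M' else true by rewrite ok.
exact: (elimT allP srch l lin).
Qed.

(** The points 0 and 7 play x_0 and x_1: 0 - 7 = 6 has class 1 in GF(13). *)
Definition initial_table : table :=
  mkseq (fun i => mkseq (fun j =>
    if i == j then 0
    else if (i == 0) || (j == 0) || (i == 7) || (j == 7) then cyc13 i j else 5) 13) 13.

Definition unknown_cells : seq (nat * nat) :=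
  [seq ij <- all_pairs | (ij.2 < ij.1) && (entry initial_table ij.1 ij.2 == 5)].

Lemma search_initial : search unknown_cells initial_table.
Proof. by vm_compute. Qed.

Section Labelling.
Variable L : nat -> nat -> nat.
Hypothesis L_lt5 : forall i j, L i j < 5.
Hypothesis L_star : forall i j, L j i = star5 (L i j).
Hypothesis L_eq0 : forall i j, i < 13 -> j < 13 -> (L i j == 0) = (i == j).
Hypothesis L_row0 : forall i, i < 13 -> L 0 i = cyc13 0 i.
Hypothesis L_row7 : forall i, i < 13 -> L 7 i = cyc13 7 i.
Hypothesis L_paths : forall i j, i < 13 -> j < 13 -> L i j = 1 -> forall a b,
  count (fun z => (L i z == a) && (L z j == b)) (iota 0 13) <= cyc13_num a b.

Definition agrees (M : table) : Prop :=
  forall i j, entry M i j != 5 -> [/\ i < 13, j < 13 & entry M i j = L i j].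

Lemma agrees_paths_ok M x y w : agrees M -> paths_ok M x y w.
Proof.
move=> agM; rewrite /paths_ok; case: ifP => // /and3P[/eqP xy a5 b5].
have [x13 y13 Lxy] : [/\ x < 13, y < 13 & entry M x y = L x y] by apply: agM; rewrite xy.
apply: leq_trans (L_paths x13 y13 _ _ _); last by rewrite -Lxy.
apply: sub_count => z /andP[/eqP ez /eqP ez'].
have [_ _ <-] : [/\ x < 13, z < 13 & entry M x z = L x z] by apply: agM; rewrite ez.
have [_ _ <-] : [/\ z < 13, y < 13 & entry M z y = L z y] by apply: agM; rewrite ez'.
by rewrite ez ez' !eqxx.
Qed.

Lemma agrees_update M i j : agrees M -> i < 13 -> j < 13 ->
  agrees (update (update M i j (L i j)) j i (star5 (L i j))).
Proof.
move=> agM i13 j13 x y; rewrite !entry_update.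
case: andP => [[/eqP-> /eqP->]|_]; first by rewrite -L_star.
by case: andP => [[/eqP-> /eqP->]|_] //; apply: agM.
Qed.

(** The search is followed along the branch that writes the true label [L i j] in each cell;
    agreement with [L] is preserved and makes every consistency test succeed. *)
Lemma search_sound cells M : agrees M ->
    all (fun ij => (ij.2 < ij.1) && (ij.1 < 13)) cells -> search cells M ->
  (forall i j, i < 13 -> j < 13 -> L i j = cyc13 i j) \/
  (forall i j, i < 13 -> j < 13 -> L i j = cyc13 (swap25 i) (swap25 j)).
Proof.
elim: cells M => [|[i j] cells IH] M agM.
  have mem_pair i j : i < 13 -> j < 13 -> (i, j) \in all_pairs.
    by move=> i13 j13; apply: allpairs_f; rewrite mem_iota.
  have nz c : (nth 0 cyc13_class c == 5) = false.
    by do 14?[case: c => [|c] //].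
  have cyc_neq5 i j : cyc13 i j != 5 by rewrite /cyc13 nz.
  move=> _ /orP[] /allP /= h; [left | right] => i j i13 j13;
    have /eqP /= e := h _ (mem_pair _ _ i13 j13); rewrite -e;
    by have [|_ _ ->] := agM i j; rewrite ?e.
case/andP=> /andP[/= ji i13] cells_ok srch.
have j13 : j < 13 by apply: ltn_trans ji i13.
have L0 : L i j != 0 by rewrite L_eq0 // gtn_eqF.
have agM' := agrees_update agM i13 j13.
apply: (IH _ agM' cells_ok).
have : L i j \in [:: 1; 2; 3; 4].
  by move: L0 (L_lt5 i j); case: (L i j) => [|[|[|[|[|?]]]]].
move=> /(search_step srch); apply.
by apply/allP => z _; rewrite !agrees_paths_ok.
Qed.

Lemma labelling_unique :
  (forall i j, i < 13 -> j < 13 -> L i j = cyc13 i j) \/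
  (forall i j, i < 13 -> j < 13 -> L i j = cyc13 (swap25 i) (swap25 j)).
Proof.
apply: (@search_sound unknown_cells initial_table); last exact: search_initial.
  have star_cyc i j : i < 13 -> j < 13 -> star5 (cyc13 j i) = cyc13 i j.
    move=> i13 j13; apply/eqP; move: i j i13 j13.
    suff : all (fun ij => star5 (cyc13 ij.2 ij.1) == cyc13 ij.1 ij.2) all_pairs.
      by move/allP => h i j i13 j13; apply: (h (i, j)); apply: allpairs_f; rewrite mem_iota.
    by vm_compute.
  move=> i j; rewrite /entry /initial_table.
  have [i13|i13] := ltnP i 13; last by rewrite (@nth_default _ [::]) ?size_mkseq // nth_nil.
  rewrite nth_mkseq //; have [j13|j13] := ltnP j 13; last by rewrite nth_default ?size_mkseq.
  rewrite nth_mkseq //; have [->|_] := eqVneq i j.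
    by split=> //; apply/esym/eqP; rewrite L_eq0.
  case: ifP => // h _; split=> //; move: h; rewrite -!orbA => /or4P[] /eqP e; subst.
  - by rewrite L_row0.
  - by rewrite L_star L_row0 // star_cyc.
  - by rewrite L_row7.
  - by rewrite L_star L_row7 // star_cyc.
by vm_compute.
Qed.

End Labelling.

(** * Recognizing Cyc(13,4) *)

Lemma cyc13_classE (l : 'I_5) (z : 'F_13) : l != ord0 ->
  (z \in [:: 2%:R ^+ l; 2%:R ^+ (l + 4); 2%:R ^+ (l + 8)])%R = (nth 0 cyc13_class z == l).
Proof.
case: l => l l5 /=; rewrite -val_eqE /=; case: z => m m13 l0.
case: l l5 l0 => [|[|[|[|[|l]]]]] //= l5 _.
all: by case: m m13 => [|[|[|[|[|[|[|[|[|[|[|[|[|m]]]]]]]]]]]]] // m13; vm_compute.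
Qed.

Lemma cyc13E (x y : 'F_13) : cyc13 x y = nth 0 cyc13_class (x - y)%R.
Proof. by rewrite /cyc13 /= modnDmr. Qed.

Lemma Cyc13_4E (l : 'I_5) (x y : 'F_13) : Cyc13_4 l x y = (cyc13 x y == l).
Proof.
rewrite /Cyc13_4 /cyc_rel cyc13E; have [->|l0] := eqVneq l ord0.
  rewrite -subr_eq0; case: (x - y)%R => m.
  by case: m => [|[|[|[|[|[|[|[|[|[|[|[|[|m]]]]]]]]]]]]] // m13.
rewrite -cyc13_classE //.
(* 2^4 has order 3, so each coset has the three elements listed in [cyc13_classE]. *)
have pow k : (2%:R ^+ (l + 4 * k) = 2%:R ^+ (l + 4 * (k %% 3)) :> 'F_13)%R.
  have -> : l + 4 * k = 12 * (k %/ 3) + (l + 4 * (k %% 3)) by have := divn_eq k 3; lia.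
  rewrite (exprD _ (12 * _) (l + _)) (exprM _ 12).
  have -> : (2%:R ^+ 12 = 1 :> 'F_13)%R by apply: val_inj.
  by rewrite expr1n mul1r.
have card13 : #|'F_13| = 13 by rewrite card_Fp.
apply/idP/idP => [/existsP[k /eqP->]|].
  rewrite pow; have := ltn_pmod k (isT : 0 < 3).
  by case: (k %% 3) => [|[|[|//]]] _; rewrite ?addn0 !inE eqxx ?orbT.
have bnd m : m < 13 -> m < #|'F_13| by rewrite card13.
rewrite !inE => /or3P[] e; apply/existsP.
- by exists (Ordinal (bnd 0 isT)); rewrite addn0.
- by exists (Ordinal (bnd 1 isT)).
- by exists (Ordinal (bnd 2 isT)).
Qed.

Lemma swap25K : involutive swap25.
Proof. by do 6?[case=> //]; rewrite /swap25 => n; do 2?case: eqP => // ->. Qed.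

Lemma swap25_lt m : m < 13 -> swap25 m < 13.
Proof. by rewrite /swap25; do 2?case: eqP. Qed.

Section Isomorphism.
Variables (X : finType) (d : nat) (R : 'I_d.+1 -> rel X).
Hypothesis schR : is_scheme R.
Variable h : 'I_5 -> 'I_d.+1.
Hypothesis h_bij : bijective h.
Hypothesis h_star : forall l l' : 'I_5, val l' = star5 l -> star R (h l) = h l'.
Hypothesis h0 : h ord0 = ord0.
Hypothesis X13 : #|X| = 13.
Hypothesis h_num : forall a b l : 'I_5, val l = 1 -> pnum R (h a) (h b) (h l) = cyc13_num a b.

Lemma label_ex (x y : X) : exists l : 'I_5, R (h l) x y.
Proof.
have [l Rl] := rel_ex schR x y; have [h' _ h'K] := h_bij.
by exists (h' l); rewrite h'K.
Qed.

Definition label (x y : X) : 'I_5 := xchoose (label_ex x y).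

Lemma labelE l x y : R (h l) x y = (label x y == l).
Proof.
have Rl := xchooseP (label_ex x y); rewrite -/(label x y) in Rl.
apply/idP/eqP => [Rl'|<-//].
exact: (bij_inj h_bij (rel_uniq schR Rl Rl')).
Qed.

Lemma label_star x y : label y x = star5 (label x y) :> nat.
Proof.
have lt5 : star5 (label x y) < 5 by case: (label x y) => [[|[|[|[|[|?]]]]]].
have : R (h (label x y)) x y by rewrite labelE.
rewrite -[R _ _ _](rel_star schR) (h_star (l' := Ordinal lt5)) //.
by rewrite labelE => /eqP->.
Qed.

Lemma label_eq0 x y : (label x y == 0 :> nat) = (x == y).
Proof. by rewrite -(rel_diag schR) -h0 labelE -val_eqE. Qed.

Lemma card_label x y (a b : nat) : label x y = 1 :> nat -> a < 5 -> b < 5 ->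
  #|[set z | (label x z == a :> nat) && (label z y == b :> nat)]| = cyc13_num a b.
Proof.
move=> xy a5 b5; rewrite -(h_num (Ordinal a5) (Ordinal b5) xy).
have Rxy : R (h (label x y)) x y by rewrite labelE.
rewrite (pnumE schR _ _ Rxy); congr #|pred_of_set _|.
by apply/setP => z; rewrite !inE !labelE.
Qed.

(** The cell [C i] collects the points that lie to x_0, x_1 as [i] lies to 0, 7; the intersection
    numbers make it nonempty. Distinct indices have disjoint cells except 2 and 5, which share
    one. *)
Lemma exists_frame : exists g : 'I_13 -> X, injective g /\
  exists x0 x1, forall i : 'I_13,
    [/\ label x0 (g i) = cyc13 0 i :> nat & label x1 (g i) = cyc13 7 i :> nat].
Proof.
have [x0 [x1]] := rel_neq0 schR (h (inord 1)); rewrite labelE => /eqP x01.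
have {}x01 : label x0 x1 = 1 :> nat by rewrite x01 inordK.
pose C i := [set z | (label x0 z == cyc13 0 i :> nat) && (label z x1 == star5 (cyc13 7 i) :> nat)].
have cyc_lt5 i j : cyc13 i j < 5.
  by rewrite /cyc13; move: (_ %% 13); do 14?[case=> //].
have star_lt5 l : star5 l < 5 by do 6?[case: l => [//|l]].
have cardC (i : 'I_13) : #|C i| = cyc13_num (cyc13 0 i) (star5 (cyc13 7 i)).
  exact: card_label.
have star5K l : l < 5 -> star5 (star5 l) = l by do 6?[case: l => [//|l]].
have inC i z : z \in C i -> label x0 z = cyc13 0 i :> nat /\ label x1 z = cyc13 7 i :> nat.
  rewrite inE => /andP[/eqP-> /eqP e]; split=> //.
  by rewrite label_star e star5K.
have /fin_all_exists[g gC] : forall i : 'I_13, exists z, z \in C i.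
  move=> i; apply/card_gt0P; rewrite cardC.
  by case: i => m; do 14?[case: m => [|m] //].
pose i2 : 'I_13 := inord 2; pose i5 : 'I_13 := inord 5.
(* The shared cell has p_{3,3}^1 = 2 points, so index 5 can be given a point other than that of
   index 2. *)
have [z5 z5C z5g] : exists2 z, z \in C i5 & z != g i2.
  have : 1 < #|C i5| by rewrite cardC inordK.
  rewrite (cardsD1 (g i2)) => C2.
  have /card_gt0P[z] : 0 < #|C i5 :\ g i2| by move: C2; case: (_ \in _) => //; apply: ltnW.
  by rewrite in_setD1 => /andP[? ?]; exists z.
pose g' i := if i == i5 then z5 else g i.
have g'C i : g' i \in C i by rewrite /g'; case: eqP => [->|_].
exists g'; split; last by exists x0, x1 => i; have [] := inC _ _ (g'C i).
have sep : all (fun ij => [|| ij.1 == ij.2,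
    (cyc13 0 ij.1, cyc13 7 ij.1) != (cyc13 0 ij.2, cyc13 7 ij.2),
    ij == (2, 5) | ij == (5, 2)]) all_pairs by vm_compute.
move=> i j gij; have ij : (val i, val j) \in all_pairs by apply: allpairs_f; rewrite mem_iota ltn_ord.
have [e0 e7] := inC _ _ (g'C i); have [f0 f7] := inC _ _ (g'C j).
have val5 : val i5 = 5 by rewrite /= inordK.
have val2 : val i2 = 2 by rewrite /= inordK.
have := allP sep _ ij; rewrite /= -e0 -e7 -f0 -f7 gij eqxx /=.
case/or3P => [/eqP/val_inj//|/eqP[a b]|/eqP[a b]]; exfalso; move: gij; rewrite /g'.
  have -> : j = i5 by apply: val_inj; rewrite val5.
  have -> : i = i2 by apply: val_inj; rewrite val2.
  by rewrite eqxx -val_eqE val2 val5 /= => e; rewrite e eqxx in z5g.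
have -> : i = i5 by apply: val_inj; rewrite val5.
have -> : j = i2 by apply: val_inj; rewrite val2.
by rewrite eqxx -val_eqE val2 val5 /= => e; rewrite e eqxx in z5g.
Qed.

Lemma iso_Cyc13_4 : scheme_iso R Cyc13_4.
Proof.
have [g [g_inj [x0 [x1 gP]]]] := exists_frame.
pose G (i : nat) := g (inord i).
have GP i : i < 13 -> label x0 (G i) = cyc13 0 i :> nat /\ label x1 (G i) = cyc13 7 i :> nat.
  by move=> i13; have := gP (inord i); rewrite inordK // => -[].
have G_inj i j : i < 13 -> j < 13 -> G i = G j -> i = j.
  by move=> i13 j13 /g_inj/(congr1 val); rewrite /= !inordK.
have G0 : G 0 = x0 by apply/esym/eqP; rewrite -label_eq0; have [-> _] := GP 0 isT.
have G7 : G 7 = x1 by apply/esym/eqP; rewrite -label_eq0; have [_ ->] := GP 7 isT.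
pose L i j : nat := label (G i) (G j).
have L_paths i j : i < 13 -> j < 13 -> L i j = 1 -> forall a b,
    count (fun z => (L i z == a) && (L z j == b)) (iota 0 13) <= cyc13_num a b.
  move=> i13 j13 Lij a b.
  have [a5|a5] := ltnP a 5; last first.
    rewrite (eq_count (a2 := pred0)) ?count_pred0 // => z /=.
    by rewrite ltn_eqF // (leq_trans (ltn_ord _) a5).
  have [b5|b5] := ltnP b 5; last first.
    rewrite (eq_count (a2 := pred0)) ?count_pred0 // => z /=.
    by rewrite andbC ltn_eqF // (leq_trans (ltn_ord _) b5).
  rewrite -(card_label Lij a5 b5) -sum1_count.
  rewrite -[iota 0 13]/(index_iota 0 13) big_mkord sum1dep_card -(card_imset _ g_inj); apply: subset_leq_card.
  apply/subsetP => z /imsetP[m]; rewrite !inE => mP ->.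
  by move: mP; rewrite /L /G inord_val.
have Lu := @labelling_unique L (fun i j => ltn_ord _) (fun i j => label_star _ _).
(* Both outcomes of the search are treated at once, [s] being the identity or [swap25]. *)
have [s [sK s13 Ls]] : exists s : nat -> nat, [/\ involutive s, forall m, m < 13 -> s m < 13 &
    forall i j, i < 13 -> j < 13 -> L i j = cyc13 (s i) (s j)].
  case: Lu => //.
  - move=> i j i13 j13; rewrite label_eq0; apply/eqP/eqP => [|->//].
    exact: G_inj.
  - by move=> i i13; rewrite /L G0; have [] := GP i i13.
  - by move=> i i13; rewrite /L G7; have [] := GP i i13.
  - by exists id.
  - by exists swap25; split=> //; [exact: swap25K | exact: swap25_lt].
pose f' (z : 'F_13) := G (s z).
have lt13 (z : 'F_13) : z < 13 by exact: ltn_ord.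
have f'_inj : injective f'.
  move=> x y /G_inj e; apply: val_inj; apply: (inv_inj sK).
  by apply: e; apply: s13.
have [f fK f'K] : bijective f' by apply: inj_card_bij; rewrite // X13 card_Fp.
have [h' hK h'K] := h_bij.
exists f, h'; split; [by exists f' | by exists h|] => i x y.
rewrite Cyc13_4E -[in LHS](h'K i) labelE -{1}(f'K x) -{1}(f'K y) -val_eqE /=.
by have := Ls (s (f x)) (s (f y)) (s13 _ (lt13 _)) (s13 _ (lt13 _)); rewrite !sK /L => ->.
Qed.

End Isomorphism.

(** * Schemes generated by a non-symmetric relation *)

Lemma sum_supp (I : finType) (s : seq I) (F : I -> nat) :
  uniq s -> (forall e, e \notin s -> F e = 0) -> \sum_e F e = \sum_(e <- s) F e.
Proof.
move=> us F0; rewrite [RHS]big_uniq // [RHS]big_mkcond; apply: eq_bigr => e _.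
by case: ifPn => // /F0.
Qed.

Section Scheme.
Variables (X : finType) (d : nat) (R : 'I_d.+1 -> rel X).
Hypothesis schR : is_scheme R.

Lemma valency0 : valency R ord0 = 1.
Proof. by rewrite /valency pnum0l // star0 // eqxx. Qed.

(* Without 3-cycles, the out-neighbours of [w] in [R_i(x)] would be a proper subset of
   those of [y] for every arc [y -> w] inside [R_i(x)]. *)
Lemma regular_tournament_cycle i j :
    star R j != j -> 0 < pnum R i (star R j) i ->
    (forall x y z, R i x y -> R i x z -> y != z -> R j y z || R j z y) ->
  0 < pnum R j j (star R j).
Proof.
move=> jN outdeg tour; rewrite lt0n; apply/negP => /eqP no3.
have cyc x y z : R j x y -> R j y z -> R j z x -> False.
  move=> xy yz zx; have := pnum_neq0 schR xy yz (l := star R j).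
  by rewrite rel_star // zx no3 => /(_ isT).
have asym x y : R j x y -> ~ R j y x.
  move=> xy yx; case/eqP: jN; apply: (rel_uniq schR (x := x) (y := y)) => //.
  by rewrite rel_star.
have [x [y Rxy]] := rel_neq0 schR i.
pose O y := [set z | R i x z && R j y z].
have cardO z : R i x z -> #|O z| = pnum R i (star R j) i.
  move=> Rz; rewrite (pnumE schR _ _ Rz); congr #|pred_of_set _|.
  by apply/setP => w; rewrite !inE rel_star.
have [w] : exists w, w \in O y by apply/set0Pn; rewrite -card_gt0 cardO.
rewrite inE => /andP[xw yw].
have : O w \proper O y.
  apply/properP; split; last first.
    exists w; rewrite inE ?xw //=; apply/negP => ww; exact: (asym w w).
  apply/subsetP => v; rewrite !inE => /andP[xv wv]; rewrite xv /=.
  have yv : y != v by apply/eqP => yv; apply: (asym y w) => //; rewrite yv.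
  by case/orP: (tour _ _ _ Rxy xv yv) => // vy; case: (cyc y w v).
by move/proper_card; rewrite !cardO // ltnn.
Qed.

Hypothesis comR : commutative_scheme R.

Lemma closed_set_star_closed (F : {set 'I_d.+1}) :
    (forall i, i \in F -> star R i \in F) ->
    (forall i j l, i \in F -> j \in F -> l \notin F -> pnum R i j l = 0) ->
  closed_set R F.
Proof.
move=> Fstar F0 i j iF jF; apply/subsetP => l; rewrite inE.
case/existsP => i' /andP[/set1P-> /existsP[j' /andP[/set1P-> ]]].
by apply: contraNT => lF; rewrite F0 ?Fstar.
Qed.

(** * Parameters of the relations R_1 and R_2 *)

Variables i1 i2 : 'I_d.+1.
Local Notation j1 := (star R i1).
Local Notation j2 := (star R i2).
Local Notation i0 := (ord0 : 'I_d.+1).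
Hypotheses (gen1 : generates R i1) (i1N : j1 != i1) (i12 : i2 != i1).
Hypothesis sq1 : relprod R [set i1] [set i1] \subset [set i1; j1; i2].
Hypothesis sym1 : relprod R [set i1] [set j1] \subset [set ord0; i1; j1; i2; j2].
Hypothesis i2N : i2 \notin [set j1; j2].
Local Notation P := (pnum R).
Local Notation k := (valency R i1).
Local Notation k2 := (valency R i2).
Local Notation p := (P i1 i1 i1).
Local Notation q := (P i1 i1 j1).
Local Notation r := (P i1 i1 i2).
Local Notation t := (P i1 j1 i2).
Local Notation u := (P i1 j2).
Local Notation w := (P i1 i2).
Local Notation F := [:: i0; i1; j1; i2; j2].

Lemma pnum_starV i j l : P i j (star R l) = P (star R j) (star R i) l.
Proof. by rewrite -[in RHS](starK schR l) pnum_star. Qed.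

Lemma star_eq i j : (star R i == j) = (i == star R j).
Proof. exact: (can2_eq (starK schR) (starK schR)). Qed.

Lemma i2_neq_j1 : i2 != j1.
Proof. by move: i2N; rewrite !inE negb_or => /andP[]. Qed.

Lemma i2_neq_j2 : i2 != j2.
Proof. by move: i2N; rewrite !inE negb_or => /andP[]. Qed.

Lemma F_uniq : uniq F.
Proof.
have n1 : i0 != i1 by apply: contraNneq i1N => <-; rewrite star0.
have n2 : i0 != i2 by apply: contraNneq i2_neq_j2 => <-; rewrite star0.
have m1 : i0 != j1 by rewrite -star_eq star0.
have m2 : i0 != j2 by rewrite -star_eq star0.
have a : i1 != i2 by rewrite eq_sym.
have b : i1 != j1 by rewrite eq_sym.
have c : i1 != j2 by rewrite -star_eq eq_sym i2_neq_j1.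
have e : j1 != i2 by rewrite eq_sym i2_neq_j1.
have f : j1 != j2 by rewrite star_eq starK.
by rewrite /= !inE !negb_or n1 n2 m1 m2 a b c e f i2_neq_j2.
Qed.

Lemma F_neq : [/\ i1 != i2, i1 != j2, j1 != i2, j1 != j2 & [/\ i0 != i1, i0 != j1, i0 != i2 & i0 != j2]].
Proof.
have := F_uniq; rewrite /= !inE !negb_or -!andbA.
by case/and5P=> -> -> -> -> /and5P[_ -> -> -> /andP[-> _]].
Qed.

Lemma star_mem l : (star R l \in F) = (l \in F).
Proof.
rewrite !inE !star_eq !starK // star0 //.
by do !case: eqP.
Qed.

Lemma sq_supp l : l \notin [:: i1; j1; i2] -> P i1 i1 l = 0.
Proof.
move=> lN; apply/eqP; move: lN; apply: contraNT => Pl.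
have : l \in relprod R [set i1] [set i1].
  by rewrite inE; apply/existsP; exists i1; rewrite set11; apply/existsP; exists i1; rewrite set11.
by move/(subsetP sq1); rewrite !inE -!orbA.
Qed.

Lemma sym_supp l : l \notin F -> P i1 j1 l = 0.
Proof.
move=> lN; apply/eqP; move: lN; apply: contraNT => Pl.
have : l \in relprod R [set i1] [set j1].
  by rewrite inE; apply/existsP; exists i1; rewrite set11; apply/existsP; exists j1; rewrite set11.
by move/(subsetP sym1); rewrite !inE -!orbA.
Qed.

Lemma P11_atj2 : P i1 i1 j2 = 0.
Proof.
by apply: sq_supp; have [_ ? _ ? _] := F_neq; rewrite !inE !negb_or ![j2 == _]eq_sym i2_neq_j2; apply/and3P.
Qed.

Lemma P11'_at1 : P i1 j1 i1 = p.
Proof.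
apply/eqP; rewrite -(eqn_pmul2l (valency_gt0 schR i1)).
by rewrite pnum_triangle // starK.
Qed.

Lemma P11'_starV m : P i1 j1 (star R m) = P i1 j1 m.
Proof. by rewrite pnum_starV starK. Qed.

Lemma sum_sq1 G : \sum_e P i1 i1 e * G e = p * G i1 + q * G j1 + r * G i2.
Proof.
rewrite (@sum_supp _ [:: i1; j1; i2]); first by rewrite !big_cons big_nil addn0 addnA.
  by have := F_uniq; rewrite /= !inE !negb_or -!andbA => /and5P[_ _ _ _ /and5P[-> -> _ -> _]].
by move=> e /sq_supp->.
Qed.

Lemma sum_sym1 G :
  \sum_e P i1 j1 e * G e = k * G i0 + p * (G i1 + G j1) + t * (G i2 + G j2).
Proof.
rewrite (sum_supp F_uniq) => [|e /sym_supp-> //].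
rewrite !big_cons big_nil pnum_at0 // eqxx !P11'_starV P11'_at1; lia.
Qed.

(** Coefficient of R_m in (AA)A' = A(AA'); the term p AA' occurs on both sides and cancels. *)
Lemma balance m :
  r * u (star R m) + q * P i1 i1 (star R m) =
  k * (i1 == m) + p * P i1 i1 m + t * (w m + u m).
Proof.
have := pnum_assoc schR i1 i1 j1 m; rewrite sum_sq1 sum_sym1 pnum0r //.
by rewrite !pnum_starV !starK // (comR i2 j1); lia.
Qed.

Lemma k_gt0 : 0 < k. Proof. exact: valency_gt0. Qed.
Lemma k2_gt0 : 0 < k2. Proof. exact: valency_gt0. Qed.

(** This and the next four values of [u] and [w] come from rotating triangles with
    [pnum_triangle]. *)
Lemma w_at1 : w i1 = u i1.
Proof. by apply/eqP; rewrite -(eqn_pmul2l k_gt0) pnum_triangle. Qed.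

Lemma u_at1 : k * u i1 = k2 * t.
Proof. by rewrite -w_at1 comR pnum_triangle. Qed.

Lemma u_atj1 : k * u j1 = k2 * r.
Proof.
by rewrite comR -(valency_star schR i1) pnum_triangle // valency_star // pnum_star.
Qed.

Lemma w_atj1 : w j1 = 0.
Proof.
apply/eqP; rewrite -(eqn_pmul2l k_gt0) muln0 comR -(valency_star schR i1).
by rewrite pnum_triangle // -{2}(starK schR i2) pnum_star // P11_atj2 muln0.
Qed.

Lemma w_at2 : w i2 = u j2.
Proof.
apply/eqP; rewrite -(eqn_pmul2l k2_gt0) pnum_triangle // (comR i2 j2).
by rewrite -[in eqbRHS](valency_star schR i2) [in eqbRHS]pnum_triangle // starK.
Qed.

Lemma u_at0 : u i0 = 0.
Proof. by rewrite pnum_at0 //; have [_ _ _ /negPf-> _] := F_neq; rewrite muln0. Qed.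

(** Row sums of A^2, where r k_2 = k [u j1], divided by k. The next lemma does the same for AA',
    where t k_2 = k [u i1]. *)
Lemma k_sq : k = p + q + u j1.
Proof.
apply/eqP; rewrite -(eqn_pmul2l k_gt0) -(sum_pnum_l schR).
under eq_bigr do rewrite mulnC.
by rewrite sum_sq1 valency_star //; have := u_atj1; lia.
Qed.

Lemma k_sym : k = 1 + 2 * p + 2 * u i1.
Proof.
apply/eqP; rewrite -(eqn_pmul2l k_gt0) -{2}(valency_star schR i1) -(sum_pnum_l schR).
under eq_bigr do rewrite mulnC.
by rewrite sum_sym1 !valency_star // valency0; have := u_at1; lia.
Qed.

(* The valency-weighted part of [v] outside the span of I, A, A', B, B'. *)
Definition leak (v : 'I_d.+1 -> nat) := \sum_(m | m \notin F) valency R m * v m.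

Lemma sum_split v : \sum_m valency R m * v m =
  valency R i0 * v i0 + k * (v i1 + v j1) + k2 * (v i2 + v j2) + leak v.
Proof.
rewrite (bigID (mem F)) /= -/(leak v) -big_uniq ?F_uniq //.
by rewrite !big_cons big_nil !valency_star //=; lia.
Qed.

(** Row sums of AB': the part on R_1 and R_1* equals k_2 (t + r), so k_2 divides every other term
    and hence the leak. *)
Lemma k_u : exists g, leak u = k2 * g /\ k = t + r + u j2 + u i2 + g.
Proof.
have := sum_pnum_l schR i1 j2; rewrite valency_star // sum_split u_at0 muln0 add0n.
rewrite mulnDr u_at1 u_atj1 => e.
exists (k - (t + r + u j2 + u i2)).
have le : t + r + u j2 + u i2 <= k.
  by rewrite -(leq_pmul2l k2_gt0); lia.
by rewrite mulnBr; split; lia.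
Qed.

Lemma leak_star v : leak (fun m => v (star R m)) = leak v.
Proof.
rewrite /leak (reindex_inj (inv_inj (starK schR))) /=.
apply: eq_big => m; first by rewrite star_mem.
by rewrite starK // valency_star.
Qed.

Lemma balance_out m : m \notin F -> r * u (star R m) = t * (w m + u m).
Proof.
move=> mF; have nF l : l \notin F -> P i1 i1 l = 0.
  move=> lF; apply: sq_supp; move: lF; apply: contra.
  by rewrite !inE => /or3P[]->; rewrite ?orbT.
have := balance m; rewrite (nF m mF) (nF (star R m)) ?star_mem // !muln0 !addn0.
have /negPf-> : i1 != m by apply: contraNneq mF => <-; rewrite !inE eqxx orbT.
by rewrite muln0 add0n.
Qed.

(** The weighted sum of [balance_out], with the contribution of [w] dropped; transposition does not
    change a leak. *)
Lemma leak_le : t * leak u <= r * leak u.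
Proof.
rewrite -[in leqRHS]leak_star /leak !big_distrr leq_sum //= => m mF.
rewrite mulnCA [leqRHS]mulnCA balance_out // leq_mul2l orbC.
by rewrite leq_mul2l leq_addl orbT.
Qed.

(** * The number of classes *)

Lemma leak_eq0 v m : leak v = 0 -> m \notin F -> v m = 0.
Proof.
move/eqP; rewrite sum_nat_eq0 => /forallP/(_ m)/implyP h /h.
by rewrite muln_eq0 -[_ == 0]negbK -lt0n (valency_gt0 schR) => /eqP.
Qed.

(** The five relations in [F] form a closed set containing the generator R_1, so they are all the
    relations. *)
Lemma class4 : 0 < t -> (forall m, m \notin F -> u m = 0) -> (forall m, m \notin F -> w m = 0) -> d = 4.
Proof.
move=> t_gt0 u0 w0.
have P1_out e m : e \in F -> m \notin F -> P i1 e m = 0.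
  move=> + mF; rewrite !inE => /or4P[/eqP->|/eqP->|/eqP->|/orP[]/eqP->].
  - by rewrite pnum0r //; case: eqP mF => // <-; rewrite !inE eqxx orbT.
  - by apply: sq_supp; move: mF; rewrite !inE !negb_or => /and5P[_ -> -> ->].
  - exact: sym_supp.
  - exact: w0.
  - exact: u0.
have Pj1_out e m : e \in F -> m \notin F -> P j1 e m = 0.
  move=> eF mF; rewrite -(starK schR e) -(starK schR m) pnum_star // comR.
  by apply: P1_out; rewrite star_mem.
(* In (AA')B = A(A'B) the right side stays in the span of [F], while the left side contains t(BB +
   B'B) with t > 0. *)
have P2_out e m : e = i2 \/ e = j2 -> m \notin F -> P e i2 m = 0.
  move=> ej mF; have := pnum_assoc schR i1 j1 i2 m; rewrite sum_sym1.
  rewrite [X in _ = X -> _]big1 => [|f _].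
    by case: ej => ->; nia.
  have [fF|fF] := boolP (f \in F); first by rewrite P1_out // muln0.
  by rewrite Pj1_out // !inE eqxx !orbT.
have F0 i j l : i \in F -> j \in F -> l \notin F -> P i j l = 0.
  move=> iF jF lF; move: (iF).
  rewrite !inE => /or4P[/eqP->|/eqP->|/eqP->|ij]; rewrite ?P1_out ?Pj1_out //.
    by rewrite pnum0l //; case: eqP lF => // <-; rewrite jF.
  move: (jF).
  rewrite !inE => /or4P[/eqP->|/eqP->|/eqP->|]; try by rewrite comR ?P1_out ?Pj1_out.
    by rewrite pnum0r //; case: eqP lF => // <-; rewrite iF.
  move=> /orP[]/eqP-> ; first by apply: P2_out => //; case/orP: ij => /eqP; auto.
  rewrite -(starK schR i) -(starK schR l) pnum_star // comR; apply: P2_out; last by rewrite star_mem.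
  by case/orP: ij => /eqP->; rewrite ?starK //; auto.
have FT : [set l in F] = setT.
  apply: gen1; last by rewrite !inE eqxx orbT.
  apply: closed_set_star_closed => [i|i j l]; rewrite !in_set; first by rewrite star_mem.
  exact: F0.
have := congr1 (fun A : {set 'I_d.+1} => #|A|) FT.
by rewrite cardsT card_ord cardsE (card_uniqP F_uniq) /= => -[<-].
Qed.

Lemma balance_at1 : r * u j1 + q * q = k + p * p + 2 * t * u i1.
Proof. by have := balance i1; rewrite eqxx w_at1; lia. Qed.

Lemma balance_at2 : r * u j2 = p * r + t * (u j2 + u i2).
Proof.
have [/negPf ne _ _ _ _] := F_neq.
by have := balance i2; rewrite ne P11_atj2 w_at2; lia.
Qed.

Lemma balance_atj2 : r * u i2 + q * r = t * (w j2 + u j2).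
Proof.
have [_ /negPf ne _ _ _] := F_neq.
by have := balance j2; rewrite ne P11_atj2 starK //; lia.
Qed.

Lemma class4_of_u : 0 < t -> (forall m, m \notin F -> u m = 0) -> d = 4.
Proof.
move=> t_gt0 u0; apply: class4 => // m mF; have := balance_out mF.
by rewrite !u0 ?star_mem // muln0; nia.
Qed.

(** Two out-neighbours of a point under R_1 are joined by a relation in R_1* R_1 = R_1 R_1*, so R_j
    induces a regular tournament on them. *)
Lemma out_cycle j :
    star R j != j -> 0 < P i1 (star R j) i1 ->
    (forall l, 0 < P i1 j1 l -> l \in [:: i0; j; star R j]) ->
  0 < P j j (star R j).
Proof.
move=> jN deg supp; apply: (regular_tournament_cycle jN deg) => x y z xy xz yz.
have [l Rl] := rel_ex schR y z.
have yx : R j1 y x by rewrite rel_star.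
have := pnum_neq0 schR yx xz Rl; rewrite comR => /supp.
rewrite !inE => /or3P[] /eqP e; move: Rl; rewrite e.
- by rewrite rel_diag // (negPf yz).
- by move=> ->.
- by rewrite rel_star // => ->; rewrite orbT.
Qed.

Lemma t_gt0 : 1 < k -> 0 < t.
Proof.
move=> k_gt1; rewrite lt0n; apply/negP => /eqP t0.
(* With t = 0 also [u i1] = 0, and [k_sym] becomes k = 1 + 2p. *)
have p_gt0 : 0 < p.
  have := u_at1; rewrite t0 muln0 => /eqP.
  rewrite muln_eq0 (gtn_eqF k_gt0) /= => /eqP u0.
  by have := k_sym; lia.
(* If r > 0, the balance at R_2* gives q = 0, whereas R_1 induces a regular tournament on the
   out-neighbours and so has directed triangles. *)
have [r0|r_gt0] := posnP r; last first.
  have q0 : q = 0 by have := balance_atj2; rewrite t0 mul0n; nia.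
  suff : 0 < q by rewrite q0.
  apply: out_cycle => // [|l]; first by rewrite P11'_at1.
  move=> Pl; have : l \in F by apply: contraTT Pl => /sym_supp->.
  rewrite !inE => /or4P[->|->|->|/orP[]/eqP e]; rewrite ?orbT //.
    by rewrite e t0 in Pl.
  by rewrite e P11'_starV t0 in Pl.
have FT : [set l in [:: i0; i1; j1]] = setT.
  apply: gen1; last by rewrite !inE eqxx orbT.
  have sq l : l \notin [:: i0; i1; j1] -> P i1 i1 l = 0.
    rewrite !inE !negb_or => /and3P[l0 l1 lj].
    have [->//|l2] := eqVneq l i2.
    by apply: sq_supp; rewrite !inE !negb_or l1 lj.
  have sym l : l \notin [:: i0; i1; j1] -> P i1 j1 l = 0.
    rewrite !inE !negb_or => /and3P[l0 l1 lj].
    have [->//|l2] := eqVneq l i2; have [->|l3] := eqVneq l j2.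
      by rewrite P11'_starV.
    by apply: sym_supp; rewrite !inE !negb_or l0 l1 lj l2.
  have starF l : (star R l \in [:: i0; i1; j1]) = (l \in [:: i0; i1; j1]).
    by rewrite !inE !star_eq !starK // star0 //; do !case: eqP.
  apply: closed_set_star_closed => [i|i j l]; rewrite !in_set ?starF //.
  move=> iF jF lF; move: iF jF.
  rewrite !inE => /or3P[/eqP->|/eqP->|/eqP->] /or3P[/eqP->|/eqP->|/eqP->];
    rewrite ?sq ?sym ?pnum0l ?pnum0r //;
    try by case: eqP lF => // <-; rewrite !inE eqxx ?orbT.
    by rewrite comR sym.
  by rewrite -(starK schR l) pnum_star // sq // starF.
have [_ _ /negPf n2 _ [_ _ /negPf n0 _]] := F_neq.
move/setP/(_ i2): FT; rewrite !inE ![i2 == _]eq_sym n0 n2.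
by have [/negPf ne _ _ _ _] := F_neq; rewrite ne.
Qed.

(** The first alternative is r = 0. The premise [u j2 = t] in the second is what pseudocyclicity
    supplies later. *)
Lemma class4_parameters : 1 < k -> k2 <= k ->
  d = 4 /\ ([/\ r = 0, u j2 = 0, u i1 = k2 & k = 1 + 2 * p + 2 * k2] \/
     k2 = k /\ (u j2 = t -> [/\ t = 1, r = 1, p = 0, u i2 = 0 & q = 2] /\ w j2 = 1)).
Proof.
move=> k_gt1 k2_le; have t_gt0 := t_gt0 k_gt1.
have ku := u_at1; have kv := u_atj1; have ks := k_sq; have ky := k_sym.
have b1 := balance_at1; have b2 := balance_at2; have b3 := balance_atj2.
have [r0|r_gt0] := posnP r.
  split.
    apply: class4_of_u => // m mF.
    by have := balance_out mF; rewrite r0; clear -t_gt0; nia.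
  have u_gt0 : 0 < u i1.
    by rewrite -(ltn_pmul2l k_gt0) muln0 ku muln_gt0 k2_gt0.
  have ukk : u i1 = k2.
    move: kv b1; rewrite r0 muln0 => /eqP.
    rewrite muln_eq0 (gtn_eqF k_gt0) /= => /eqP v0; rewrite v0 in ks.
    have -> : q = 1 + p + 2 * u i1 by lia.
    (* After division by 2 [u i1], the balance at R_1 says t = 1 + 2p + 2 [u i1]. *)
    rewrite [in RHS]ky => b1; have tk : t = k by rewrite ky; clear -b1 u_gt0; nia.
    by apply/eqP; rewrite -(eqn_pmul2l k_gt0) ku tk mulnC.
  left; split=> //; first by move: b2; rewrite r0; clear -t_gt0; nia.
  by rewrite -ukk.
have [g [leakE kE]] := k_u.
have g_le : t * g <= r * g.
  have := leak_le; rewrite leakE !(mulnCA _ k2) leq_pmul2l ?k2_gt0 //.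
have [] := parameters_dichotomy k2_gt0 k2_le t_gt0 r_gt0 ku kv ks ky b1 b2 b3 kE g_le.
  case=> rt p0 b0 a0 u1_gt0; exfalso.
  (* For r = t, adding [balance_out] at R_m and at its transpose cancels [u] and leaves a vanishing
     sum of two values of [w]. *)
  have w0 m : m \notin F -> w m = 0.
    move=> mF; have := balance_out mF; have := balance_out (m := star R m).
    by rewrite star_mem mF starK // => /(_ isT); rewrite rt; clear -t_gt0; nia.
  (* The coefficient of R_2* in (AA)B = A(AB) contains r p_{2,2}^{2*} on the left, and every term on
     the right vanishes. Yet p = 0 makes R_2 a regular tournament on the out-neighbours under
     R_1. *)
  suff : 0 < P i2 i2 j2.
    have := pnum_assoc schR i1 i1 i2 j2; rewrite sum_sq1.
    rewrite [X in _ = X -> _]big1 => [|e _]; first by clear -r_gt0; nia.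
    have [|eF] := boolP (e \in F); last by rewrite w0.
    rewrite !inE => /or4P[/eqP->|/eqP->|/eqP->|/orP[]/eqP->].
    - rewrite pnum_at0 //.
      by have [_ _ /negPf-> _ _] := F_neq; rewrite muln0.
    - by rewrite P11_atj2 muln0.
    - by rewrite w_atj1.
    - by rewrite w_at2 a0.
    - by rewrite a0 muln0.
  apply: out_cycle => // [|l Pl]; first by rewrite eq_sym i2_neq_j2.
  have : l \in F by apply: contraTT Pl => /sym_supp->.
  rewrite !inE => /or4P[->|/eqP e|/eqP e|->]; rewrite ?orbT //.
    by rewrite e P11'_at1 p0 in Pl.
  by rewrite e P11'_starV P11'_at1 p0 in Pl.
case=> g0 kk fin; split; last by right.
apply: class4_of_u => // m; apply: leak_eq0.
by rewrite leakE g0 muln0.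
Qed.

Lemma P22'_at1 : k * P i2 j2 i1 = k2 * u j2.
Proof. by rewrite pnum_triangle // starK // w_at2. Qed.

(** * The pseudocyclic case *)

Section PseudocyclicCase.
Hypotheses (k_gt1 : 1 < k) (k2_le : k2 <= k) (pseudoR : pseudocyclic R).

Lemma F_full l : l \in F.
Proof.
have [d4 _] := class4_parameters k_gt1 k2_le.
suff /subset_cardP/(_ (subset_predT _))-> : #|F| = #|'I_d.+1| by [].
by rewrite (card_uniqP F_uniq) card_ord /= d4.
Qed.

(* The coefficient of [A_1] in [sum_j A_j A_j* / k_j], with [m] the common multiplicity. *)
Lemma pseudocyclic_count : exists m, 2 * m = k + k2 /\ 2 * (p + u j2) * m + k = k * m.
Proof.
have [d4 _] := class4_parameters k_gt1 k2_le.
have [E [idE rkE]] := pseudoR.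
have [_ _ _ _ [i0_1 _ _ _]] := F_neq.
have i1_0 : i1 != i0 by rewrite eq_sym.
have [nE sumE] := pseudocyclic_sum schR idE (fun i i0 => rkE i i1 i0 i1_0).
move: (\rank (E i1)) nE sumE => m nE sumE; exists m.
have card_X : #|X| = 1 + 2 * k + 2 * k2.
  rewrite -(sum_valency schR); transitivity (\sum_(i <- F) valency R i).
    by apply: sum_supp; [exact: F_uniq | move=> e; rewrite F_full].
  by rewrite !big_cons big_nil !valency_star // valency0 /=; lia.
rewrite d4 card_X in nE; have Em : 2 * m = k + k2 by lia.
split=> //.
have sum_F (G : 'I_d.+1 -> algC) : (\sum_i G i = \sum_(i <- F) G i)%R.
  by rewrite [RHS]big_uniq ?F_uniq //; apply: eq_bigl => i; rewrite F_full.
have := sumE i1 i1_0; rewrite sum_F !big_cons big_nil /=.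
rewrite !starK // pnum0l // star0 // (negPf i0_1) (comR j1) (comR j2) P11'_at1 !valency_star //.
have P22 := P22'_at1; set x := P i2 j2 i1 in P22 *.
have k_neq0 : (k%:R != 0 :> algC)%R by rewrite pnatr_eq0 -lt0n k_gt0.
have k2_neq0 : (k2%:R != 0 :> algC)%R by rewrite pnatr_eq0 -lt0n k2_gt0.
have m_neq0 : (m%:R != 0 :> algC)%R by rewrite pnatr_eq0 -lt0n; have := k_gt0; clear -Em; lia.
have -> : (x%:R / k2%:R = (u j2)%:R / k%:R :> algC)%R.
  by apply/eqP; rewrite eqr_div // -!natrM eqr_nat mulnC P22 mulnC.
move=> e; apply/eqP; rewrite -(eqr_nat algC) natrD !natrM natrD; apply/eqP.
have {}e : (2%:R * (p%:R + (u j2)%:R) / k%:R = 1 - m%:R^-1 :> algC)%R.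
  by rewrite -e mulr0n mul0r; field.
have /= := congr1 (fun z => z * (k%:R * m%:R))%R e.
have -> : (2%:R * (p%:R + (u j2)%:R) / k%:R * (k%:R * m%:R) = 2%:R * (p%:R + (u j2)%:R) * m%:R :> algC)%R.
  by field.
by move->; field.
Qed.

Lemma pseudocyclic_parameters :
  [/\ k = 3, k2 = 3, p = 0 & q = 2] /\
  [/\ u i1 = 1, u j1 = 1, u i2 = 0, u j2 = 1 & w j2 = 1].
Proof.
have [d4 par] := class4_parameters k_gt1 k2_le.
have [m [Em cnt]] := pseudocyclic_count.
have ku := u_at1; have kv := u_atj1; have ky := k_sym.
case: par => [[r0 a0 _ ky']|[kk fin]].
  (* Here (1 + 2 k_2) m = k, which is incompatible with 2m = k + k_2. *)
  exfalso; move: k2_gt0 Em cnt ky'; rewrite a0 addn0; clear; nia.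
have u1 : u i1 = t by apply/eqP; rewrite -(eqn_pmul2l k_gt0) ku kk.
have v1 : u j1 = r by apply/eqP; rewrite -(eqn_pmul2l k_gt0) kv kk.
have mk : m = k by lia.
(* With m = k the count reads 2(p + [u j2]) + 1 = k, to be compared with k = 1 + 2p + 2t. *)
have at_eq : u j2 = t.
  have : k * (2 * (p + u j2) + 1) = k * k by rewrite mk in cnt; lia.
  by move/eqP; rewrite eqn_pmul2l ?k_gt0 // => /eqP; lia.
have [[t1 r1 p0 b0 q2] c1] := fin at_eq.
by rewrite kk u1 v1 at_eq ky u1 t1 p0.
Qed.

(** The order differs from that of [F] so that transposition acts on labels as [star5]. *)
Definition class_of_label (l : 'I_5) : 'I_d.+1 := tnth [tuple i0; i1; i2; j1; j2] l.

Lemma class_of_label_inj : injective class_of_label.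
Proof.
apply/tuple_uniqP => /=; have := F_uniq; rewrite /= !inE !negb_or -!andbA.
by rewrite (eq_sym i2 j1) => /and5P[-> -> -> -> /and5P[-> -> -> -> /andP[-> ->]]].
Qed.

Lemma pseudocyclic_iso : scheme_iso R Cyc13_4.
Proof.
have [d4 _] := class4_parameters k_gt1 k2_le.
have [[k3 k23 p0 q2] [u1 v1 b0 a1 c1]] := pseudocyclic_parameters.
have [n12 n1j2 nj12 nj1j2 [n01 n0j1 n02 n0j2]] := F_neq.
apply: (@iso_Cyc13_4 _ _ _ schR class_of_label).
- by apply: inj_card_bij; [exact: class_of_label_inj | rewrite !card_ord d4].
- move=> [l l5] [l' l'5] /= e; rewrite /class_of_label !(tnth_nth i0) /= e.
  by case: l l5 {e} => [|[|[|[|[|]]]]] //= _; rewrite ?starK ?star0.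
- by rewrite /class_of_label (tnth_nth i0).
- rewrite -(sum_valency schR); transitivity (\sum_(i <- F) valency R i).
    by apply: sum_supp; [exact: F_uniq | move=> e; rewrite F_full].
  by rewrite !big_cons big_nil !valency_star // valency0 k3 k23.
(* Both valencies are 3, so the factors in [pnum_triangle] cancel and the remaining numbers
   p_{a,b}^1 are read off from the known ones. *)
have cancel3 x y : 3 * x = 3 * y -> x = y by move/eqP; rewrite eqn_pmul2l // => /eqP.
have P22' : P i2 j2 i1 = 1.
  by apply: cancel3; have := P22'_at1; rewrite k3 k23 a1.
have P22 : P i2 i2 i1 = 0.
  by apply: cancel3; have := pnum_triangle schR i2 i2 i1; rewrite k3 k23 b0.
have P22'' : P j2 j2 i1 = 1.
  rewrite -(starK schR i1) pnum_star //; apply: cancel3.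
  have := pnum_triangle schR i2 i2 j1; rewrite valency_star // k3 k23 => ->.
  by rewrite -{2}(starK schR i2) pnum_star // comR c1.
have P1'2 : P j1 i2 i1 = 1.
  by rewrite -(starK schR i1) -(starK schR i2) starK // pnum_star // comR v1.
have P1'2' : P j1 j2 i1 = 0.
  by rewrite -{2}(starK schR i1) pnum_star // comR w_atj1.
have P1'1' : P j1 j1 i1 = 2 by rewrite -{3}(starK schR i1) pnum_star.
have P11' : P i1 j1 i1 = 0 by rewrite P11'_at1.
have P12 : w i1 = 1 by rewrite w_at1.
move=> [a a5] [b b5] [l l5] /= l1; rewrite /class_of_label !(tnth_nth i0) /= l1 /=.
case: a a5 => [|[|[|[|[|]]]]] //= _; case: b b5 => [|[|[|[|[|]]]]] //= _;
  rewrite ?pnum0l ?pnum0r //= ?eqxx ?(negPf n01) ?(negPf i12) ?(negPf i1N) //.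
- by rewrite eq_sym (negPf n1j2).
- by rewrite comR.
- by rewrite comR.
- by rewrite comR.
- by rewrite eq_sym (negPf n1j2).
- by rewrite comR.
- by rewrite comR.
- by rewrite comR.
Qed.

End PseudocyclicCase.

End Scheme.

Theorem theorem1p1 (X : finType) (d : nat) (R : 'I_d.+1 -> rel X)
    (i1 i2 : 'I_d.+1) :
  is_scheme R -> commutative_scheme R ->
  val i1 = 1%N -> val i2 = 2%N ->
  generates R i1 ->
  star R i1 != i1 ->
  (1 < valency R i1)%N ->
  relprod R [set i1] [set i1] \subset [set i1; star R i1; i2] ->
  relprod R [set i1] [set star R i1]
    \subset [set ord0; i1; star R i1; i2; star R i2] ->
  i2 \notin [set star R i1; star R i2] ->
  (valency R i2 <= valency R i1)%N ->
  d = 4%N /\ (pseudocyclic R -> scheme_iso R Cyc13_4).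
Proof.
move=> schR comR v1 v2 gen1 i1N k_gt1 sq1 sym1 i2N k2_le.
have i12 : i2 != i1 by rewrite -val_eqE v1 v2.
split; first by have [] := class4_parameters schR comR gen1 i1N i12 sq1 sym1 i2N k_gt1 k2_le.
exact: (pseudocyclic_iso schR comR gen1 i1N i12).
Qed.
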